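(* For all integers $n\geq 3$ and every $\lambda>-\frac{1}{2}$, the best constant $c_n(\lambda)$ in the Markov inequality $$\Vert p'\Vert_{w_\lambda}\leq c_n(\lambda)\,\Vert p\Vert_{w_\lambda},\qquad p\in\mathcal{P}_n,$$ satisfies $$\frac{(n+1)\big(n+\lambda+\frac{1}{2}\big)^2(n+2\lambda)}{(2\lambda+1)(2\lambda+5)}\leq c_n^2(\lambda)\leq\frac{\big(n+\frac{5}{4}\lambda+\frac{9}{8}\big)^4}{2(2\lambda+1)\sqrt{2\lambda+5}}.$$
   Context: $\mathcal{P}_n$ denotes the class of real algebraic polynomials of degree at most $n$. For $\lambda>-1/2$, $w_\lambda(t)=(1-t^2)^{\lambda-1/2}$ on $(-1,1)$ is the Gegenbauer weight and $\Vert f\Vert_{w_\lambda}=\big(\int_{-1}^1 w_\lambda(t)f^2(t)\,dt\big)^{1/2}$. The best Markov constant is $c_n(\lambda)=\sup\{\Vert p'\Vert_{w_\lambda}/\Vert p\Vert_{w_\lambda}: p\in\mathcal{P}_n,\ p\neq 0\}$. *)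

(* Defs.v *)
From HB Require Import structures.
From mathcomp Require Import all_boot all_order all_algebra.
From mathcomp Require Import all_classical all_reals all_analysis.
Set Implicit Arguments. Unset Strict Implicit. Unset Printing Implicit Defensive.
Import Order.TTheory GRing.Theory Num.Theory.
Import numFieldNormedType.Exports.
Local Open Scope classical_set_scope.
Local Open Scope ring_scope.

Definition gweight {R : realType} (lam : R) (t : R) : R :=
  powR (1 - t ^+ 2) (lam - 2^-1).

Definition gnorm {R : realType} (lam : R) (f : R -> R) : R :=
  Num.sqrt (Rintegral (@lebesgue_measure R) `]-1, 1[
                      (fun t => gweight lam t * f t ^+ 2)).

Definition polys_le {R : realType} (n : nat) : set {poly R} :=
  [set p | (size p <= n.+1)%N].

Definition markov_const {R : realType} (n : nat) (lam : R) : \bar R :=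
  ereal_sup [set ((gnorm lam (fun t => (p^`()).[t]) /
                   gnorm lam (fun t => p.[t]))%:E)%E
            | p in [set p | polys_le n p /\ p != 0]].

(* Main.v *)
Require Import Defs.
From HB Require Import structures.
From mathcomp Require Import all_boot all_order all_algebra.
From mathcomp Require Import all_classical all_reals all_analysis.
From mathcomp Require Import measurable_realfun ring lra.
Set Implicit Arguments.
Unset Strict Implicit.
Unset Printing Implicit Defensive.
Import Order.TTheory GRing.Theory Num.Theory.
Import numFieldNormedType.Exports.
Local Open Scope classical_set_scope.
Local Open Scope ring_scope.

(** In the orthogonal basis of Gegenbauer polynomials [e_k], differentiation
    splits by parity: [e_k' = \sum a_j e_j] over [j < k] of the other parity,
    so that for [k <= l] of equal parity [<e_k', e_l'> = |e_k'|^2], and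
    [|e_k'|^2 / |e_k|^2 = 2 k (k + lam) (k + 2 lam) / (2 lam + 1)].  On each
    parity class the squared Markov constant is therefore the largest
    eigenvalue of an explicit positive semidefinite matrix [M], and
    [tr(M^2) / tr(M) <= c_n^2 <= sqrt(tr(M^2))].  Both traces telescope to
    polynomials in [n] divided by a function of [lam]; both bounds follow by
    induction on [n] in steps of two, the increments being polynomial
    inequalities. *)

(** * The Gegenbauer weight *)

(** Both trace bounds rest on the eigenvalues mu of M being nonnegative: max mu <= sqrt(sum mu^2),
    and sum mu^2 <= max mu * sum mu. No eigenvalue or square root is ever formed: the first bound
    becomes a Cauchy-Schwarz inequality and the second a test on the columns of M, so the linear
    algebra takes place over any [realFieldType]. The Gegenbauer theory is likewise algebraic:
    orthogonality, norms and Gram entries are derived for an abstract linear functional [I] from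
    [I 1 > 0] and a single integration-by-parts identity. The analytic obstacle is to supply that
    identity for the integral: the weight is unbounded at both endpoints when lam < 1/2, so
    integrability and the vanishing of boundary terms are obtained as limits over compact
    subintervals. *)

Section weight.
Variables (R : realType).
Notation mu := (@lebesgue_measure R).

Lemma gweight_ge0 (lam t : R) : 0 <= gweight lam t.
Proof. exact: powR_ge0. Qed.

Lemma onem_sqr_gt0 (t : R) : -1 < t < 1 -> 0 < 1 - t ^+ 2.
Proof. by move=> /andP[? ?]; nra. Qed.

Lemma gweightS (lam t : R) : -1 < t < 1 ->
  gweight (lam + 1) t = (1 - t ^+ 2) * gweight lam t.
Proof.
move=> /onem_sqr_gt0 t1.
rewrite /gweight -{2}(powRr1 (ltW t1)) -powRD; first by congr (_ `^ _); lra.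
by rewrite (gt_eqF t1) implybT.
Qed.

Lemma is_derive_gweight (a t : R) : -1 < t < 1 ->
  is_derive t 1 (gweight (a + 1)) (- (2 * a + 1) * t * gweight a t).
Proof.
move=> t1; have := onem_sqr_gt0 t1 => d0.
have h1 : is_derive t 1 (fun x : R => 1 - x ^+ 2) (- (2 * t)).
  by apply: is_derive_eq; rewrite /= /GRing.scale /=; ring.
have h2 := @is_derive1_powR R (a + 1 - 2^-1) (1 - t ^+ 2) d0.
have := @is_derive1_comp R (@powR R ^~ (a + 1 - 2^-1)) (fun x : R => 1 - x ^+ 2) t _ _ h2 h1.
rewrite -[X in is_derive _ _ X]/(gweight (a + 1)) => h3; apply: (@is_derive_eq _ _ _ _ _ _ _ _ h3).
rewrite /gweight; have -> : a + 1 - 2^-1 - 1 = a - 2^-1 by lra.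
by set w := powR _ _; field.
Qed.

(** Endpoints of compact intervals filling (-1, 1), on which the weight is smooth. The shift by two
    makes the first one 1/2, so that all lie strictly between 0 and 1. *)
Definition exhaust (k : nat) : R := 1 - k.+2%:R^-1.

Lemma exhaust_itv k : 0 < exhaust k < 1.
Proof.
by rewrite /exhaust subr_gt0 invf_lt1 ?ltr1n //= gtrBl invr_gt0 ltr0n.
Qed.

Lemma exhaust_cvg : exhaust k @[k --> \oo] --> (1 : R).
Proof.
rewrite -[X in _ --> X]subr0; apply: cvgB; first exact: cvg_cst.
have := @cvg_harmonic R; rewrite -cvg_shiftS; exact.
Qed.

Lemma exhaust_nd : nondecreasing_seq exhaust.
Proof.
move=> m n mn; rewrite /exhaust lerB // lef_pV2 ?posrE ?ltr0n // ler_nat.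
by rewrite !ltnS.
Qed.

Lemma bigcup_exhaust : \bigcup_k `[- exhaust k, exhaust k]%classic = `]-1, 1[%classic.
Proof.
apply/seteqP; split => [x [k _] /=|x /=]; rewrite !in_itv /=.
  by have /andP[? ?] := exhaust_itv k; move=> /andP[? ?]; apply/andP; split; lra.
move=> /andP[x1 x2].
have : \forall k \near \oo, `|x| < exhaust k.
  apply: (cvgr_gt _ exhaust_cvg); rewrite ltr_norml x1 x2 //.
move=> [N _ /(_ N (leqnn N))] /= /ltW; rewrite ler_norml => h.
by exists N => //=; rewrite in_itv.
Qed.

Lemma exhaust_sub k x : `[- exhaust k, exhaust k]%classic x -> -1 < x < 1.
Proof.
rewrite /= in_itv /=.
by have /andP[? ?] := exhaust_itv k; move=> /andP[? ?]; apply/andP; split; lra.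
Qed.

Lemma measurable_gweight (lam : R) D : measurable_fun D (gweight lam).
Proof.
apply: measurable_funTS.
apply: (measurableT_comp (measurable_powR (lam - 2^-1))).
apply: measurable_funB => //; exact: measurable_funX.
Qed.

Lemma derivable_gweight (lam x : R) : -1 < x < 1 -> derivable (gweight lam) x 1.
Proof.
move=> x1; have -> : lam = lam - 1 + 1 by lra.
by have := is_derive_gweight (lam - 1) x1 => h; apply: ex_derive.
Qed.

(** The integrand is the derivative of [gweight (lam + 1) t * q.[t]] with [gweight lam t] factored
    out. *)
Lemma FTC_gweight (lam : R) (q : {poly R}) (r : R) : 0 < r < 1 ->
  (\int[mu]_(t in `[(- r)%R, r])
     (gweight lam t * ((1 - 'X ^+ 2) * q^`() - (2 * lam + 1) *: ('X * q)).[t])%R%:E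
  = (gweight (lam + 1) r * q.[r] - gweight (lam + 1) (- r) * q.[- r])%R%:E)%E.
Proof.
move=> /andP[r0 r1].
have sub (x : R) : - r <= x <= r -> -1 < x < 1.
  by move=> /andP[? ?]; apply/andP; split; lra.
pose f t := gweight lam t *
  ((1 - 'X ^+ 2) * q^`() - (2 * lam + 1) *: ('X * q)).[t].
pose F t := gweight (lam + 1) t * q.[t].
have dF (x : R) : -1 < x < 1 -> is_derive x 1 F (f x).
  move=> x1; have h1 := is_derive_gweight lam x1.
  have h2 : is_derive x 1 (horner q) (q^`().[x]).
    by rewrite derivE derive1E; apply/derivableP/derivable_horner.
  have h := is_deriveM h1 h2; apply: (@is_derive_eq _ _ _ _ _ _ _ _ h).
  rewrite /f !hornerE gweightS // /GRing.scale /=; ring.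
have dF1 (x : R) : -1 < x < 1 -> derivable F x 1.
  by move=> /dF h; apply: ex_derive.
have contF : {within `[- r, r], continuous F}.
  apply: derivable_within_continuous => x; rewrite in_itv /= => xr.
  exact/dF1/sub.
rewrite EFinB; apply: (@continuous_FTC2 _ f F); first by lra.
- apply: derivable_within_continuous => x; rewrite in_itv /= => /sub x1.
  apply: derivableM; [exact: derivable_gweight | exact: derivable_horner].
- have rr : - r < r by lra.
  have [h1 h2 h3] := (continuous_within_itvP F rr).1 contF.
  split => // x; rewrite in_itv /= => /andP[? ?].
  by apply/dF1/sub/andP; split; lra.
- move=> x; rewrite in_itv /= => /andP[? ?].
  have /dF [_] : -1 < x < 1 by apply/andP; split; lra.
  by rewrite derive1E.
Qed.

Lemma integrable_exhaust (f : R -> R) k :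
  (forall x : R, -1 < x < 1 -> derivable f x 1) ->
  mu.-integrable `[- exhaust k, exhaust k] (EFin \o f).
Proof.
move=> df; apply: continuous_compact_integrable; first exact: segment_compact.
apply: derivable_within_continuous => x; rewrite in_itv /= => xk.
by apply/df/(@exhaust_sub k); rewrite /= in_itv.
Qed.

Lemma gweight_le1 (lam t : R) : 2^-1 <= lam -> -1 < t < 1 -> gweight lam t <= 1.
Proof.
move=> l0 t1; have h : 0 < 1 - t ^+ 2 <= 1 by rewrite onem_sqr_gt0 //= gerBl sqr_ge0.
by have := @ger_powR R _ h 0 (lam - 2^-1); rewrite powRr0; apply; lra.
Qed.

Lemma Rintegral_gweight_le (lam : R) k : - 2^-1 < lam ->
  Rintegral mu `[- exhaust k, exhaust k] (gweight lam) <= (4 * lam + 4) / (2 * lam + 1).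
Proof.
move=> hlam; have l1 : 0 < 2 * lam + 1 by lra.
have k01 := exhaust_itv k; have /andP[k0 k1] := k01.
pose f t := gweight lam t *
  ((1 - 'X ^+ 2) * deriv 'X - (2 * lam + 1) *: ('X * 'X)).[t].
have fE (x : R) : f x = gweight lam x * (1 - x ^+ 2 - (2 * lam + 1) * x ^+ 2).
  by rewrite /f derivX !hornerE /=; ring.
have iw := integrable_exhaust k (@derivable_gweight lam).
have if_ : mu.-integrable `[- exhaust k, exhaust k] (EFin \o f).
  apply: integrable_exhaust => x x1.
  apply: derivableM; [exact: derivable_gweight | exact: derivable_horner].
have iw1 : mu.-integrable `[- exhaust k, exhaust k] (EFin \o (fun t => (2 * lam + 1) * gweight lam t)).
  by apply: integrable_exhaust => x x1; apply: derivableM => //; exact: derivable_gweight.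
have ic : mu.-integrable `[- exhaust k, exhaust k] (EFin \o (fun=> 2 * lam + 2)).
  by apply: integrable_exhaust => x x1; exact: derivable_cst.
have Ef : Rintegral mu `[- exhaust k, exhaust k] f = 2 * exhaust k * gweight (lam + 1) (exhaust k).
  rewrite /Rintegral FTC_gweight //= !hornerE /gweight sqrrN; ring.
have : Rintegral mu `[- exhaust k, exhaust k] (fun t => (2 * lam + 1) * gweight lam t + f t)
   <= Rintegral mu `[- exhaust k, exhaust k] (fun=> 2 * lam + 2).
  apply: le_Rintegral => //; first exact: (integrableD _ iw1 if_).
  move=> x /exhaust_sub x1.
  have -> : (2 * lam + 1) * gweight lam x + f x =
    (2 * lam + 2) * gweight (lam + 1) x.
    by rewrite gweightS // fE; ring.
  by rewrite ler_piMr ?gweight_le1 //; lra.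
rewrite RintegralD // RintegralZl // Ef Rintegral_cst //= lebesgue_measure_itv /= lte_fin.
rewrite gtrN // /= => h.
have h2 : 0 <= exhaust k * gweight (lam + 1) (exhaust k).
  by rewrite mulr_ge0 ?gweight_ge0 // ltW.
have h3 : 0 <= (2 * lam + 2) * (1 - exhaust k) by apply: mulr_ge0; lra.
rewrite ler_pdivlMr //; move: h h2 h3.
set W := Rintegral _ _ _; set e := exhaust k; set g := gweight _ _.
by clearbody W e g; clear; nra.
Qed.

Lemma integrable_gweight (lam : R) : - 2^-1 < lam ->
  mu.-integrable `]-1, 1[ (EFin \o gweight lam).
Proof.
move=> hlam; apply/integrableP; split.
  by apply/measurable_EFinP; exact: measurable_gweight.
under eq_integral do rewrite gee0_abs ?lee_fin ?gweight_ge0 //.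
apply: (@le_lt_trans _ _ ((4 * lam + 4) / (2 * lam + 1))%:E); last exact: ltry.
rewrite -bigcup_exhaust.
apply: (cvge_le _ (@ge0_nondecreasing_set_cvg_integral _ _ _ _ _ _ _ _ _ _)).
- near=> k; have := Rintegral_gweight_le k hlam.
  rewrite -lee_fin /Rintegral fineK //.
  by apply: integrable_fin_num => //; exact: (integrable_exhaust k (@derivable_gweight lam)).
- move=> m n /exhaust_nd mn; rewrite subsetEset => x /=; rewrite !in_itv /=.
  by move=> /andP[? ?]; apply/andP; split; lra.
- by move=> i; exact: measurable_itv.
- by move=> i; apply/measurable_EFinP; exact: measurable_gweight.
- by move=> i x _; rewrite lee_fin gweight_ge0.
Unshelve. all: by end_near.
Qed.

Lemma integrable_gweightM (lam : R) (p : {poly R}) : - 2^-1 < lam ->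
  mu.-integrable `]-1, 1[ (EFin \o (fun t => gweight lam t * p.[t])).
Proof.
move=> hlam; pose M := \sum_(i < size p) `|p`_i|.
have M0 : 0 <= M by exact: sumr_ge0.
apply: (@le_integrable _ _ _ mu _ _ _ (EFin \o (fun t => M * gweight lam t))) => //.
- apply/measurable_EFinP; apply: measurable_funM; first exact: measurable_gweight.
  exact: measurable_funTS (continuous_measurable_fun (@continuous_horner R p)).
- move=> x /=; rewrite in_itv /= => /andP[x1 x2].
  rewrite lee_fin !normrM mulrC ler_wpM2r // (ger0_norm M0).
  rewrite horner_coef; apply: (le_trans (ler_norm_sum _ _ _)).
  apply: ler_sum => i _; rewrite normrM normrX ler_piMr // exprn_ile1 //.
  by rewrite ler_norml; apply/andP; split; lra.
- exact: (integrableZl _ _ (integrable_gweight hlam)).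
Qed.

(** * The weighted integral as a linear functional on polynomials *)

Definition gint (lam : R) (p : {poly R}) : R :=
  Rintegral mu `]-1, 1[ (fun t => gweight lam t * p.[t]).

Lemma gintD (lam : R) p q : - 2^-1 < lam ->
  gint lam (p + q) = gint lam p + gint lam q.
Proof.
move=> hlam; rewrite /gint -RintegralD //; do ?exact: integrable_gweightM.
by apply: eq_Rintegral => x _; rewrite hornerD mulrDr.
Qed.

Lemma gintZ (lam c : R) p : - 2^-1 < lam ->
  gint lam (c *: p) = c * gint lam p.
Proof.
move=> hlam; rewrite /gint -RintegralZl //; last exact: integrable_gweightM.
by apply: eq_Rintegral => x _; rewrite hornerZ mulrCA.
Qed.

Lemma gint_sqr_ge0 (lam : R) p : 0 <= gint lam (p ^+ 2).
Proof.
apply: Rintegral_ge0 => x _.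
by rewrite mulr_ge0 ?gweight_ge0 // horner_exp sqr_ge0.
Qed.

Lemma gnormE (lam : R) (p : {poly R}) :
  Defs.gnorm lam (fun t => p.[t]) = Num.sqrt (gint lam (p ^+ 2)).
Proof.
by rewrite /Defs.gnorm /gint; congr Num.sqrt; apply: eq_Rintegral => x _; rewrite horner_exp.
Qed.

Lemma Rintegral_exhaust_cvg (f : R -> R) :
  mu.-integrable `]-1, 1[ (EFin \o f) ->
  Rintegral mu `[- exhaust k, exhaust k] f @[k --> \oo] --> Rintegral mu `]-1, 1[ f.
Proof.
move=> fi; have /integrableP[mf _] := fi.
pose f_ k := (EFin \o f) \_ `[- exhaust k, exhaust k].
have [] := @dominated_convergence _ _ _ mu `]-1, 1[ _ f_ (EFin \o f) (abse \o EFin \o f).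
- exact: measurable_itv.
- move=> k; apply/measurable_restrict => //.
  by apply: measurable_funS mf => //; exact: subIsetr.
- exact: mf.
- apply: aeW => x /=; rewrite in_itv /= => /andP[x1 x2].
  apply: cvg_near_cst.
  have : \forall k \near \oo, `|x| < exhaust k.
    by apply: (cvgr_gt _ exhaust_cvg); rewrite ltr_norml x1 x2.
  apply: filterS => k /ltW; rewrite ler_norml => xk.
  by rewrite /f_ patchE mem_set //= in_itv.
- exact: integrable_abse.
- apply: aeW => x k _; rewrite /f_ patchE; case: ifP => // _.
  by rewrite abse0 abse_ge0.
move=> _ _ h.
apply: fine_cvg.
rewrite fineK; last exact: integrable_fin_num.
rewrite (_ : (fun k => _) = (fun k => \int[mu]_(x in `](-1)%R, 1%R[) f_ k x)%E) //.
apply/funext => k; rewrite -integral_mkcondr setIidr // => x /exhaust_sub /=.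
by rewrite in_itv.
Qed.

Lemma gweightS_exhaust_cvg (lam : R) : - 2^-1 < lam ->
  gweight (lam + 1) (exhaust k) @[k --> \oo] --> 0.
Proof.
move=> hlam; rewrite /gweight.
have p0 : 0 < lam + 1 - 2^-1 by lra.
apply: ((cvg_at_rightP (@powR R ^~ _) 0 0).1 (powR_cvg0 p0) (fun k => 1 - exhaust k ^+ 2)).
split => [k|].
  by apply: onem_sqr_gt0; have /andP[? ->] := exhaust_itv k; rewrite andbT; lra.
rewrite [X in _ --> X](_ : _ = 1 - 1 ^+ 2); last by rewrite expr1n subrr.
apply: cvgB; first exact: cvg_cst.
apply: (@cvg_comp _ _ _ _ (fun x : R => x ^+ 2) _ _ _ exhaust_cvg).
exact: exprn_continuous.
Qed.

(** Limit of [FTC_gweight] along the exhaustion: the boundary terms carry [gweight (lam + 1)], whose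
    exponent lam + 1/2 is positive, so they tend to 0. *)
Lemma gint_by_parts (lam : R) q : - 2^-1 < lam ->
  gint lam ((1 - 'X ^+ 2) * q^`() - (2 * lam + 1) *: ('X * q)) = 0.
Proof.
move=> hlam.
have := Rintegral_exhaust_cvg (integrable_gweightM
  ((1 - 'X ^+ 2) * q^`() - (2 * lam + 1) *: ('X * q)) hlam).
rewrite -/(gint _ _) => h; apply: (cvg_unique _ h) => //.
have -> : (fun k => Rintegral mu `[- exhaust k, exhaust k] (fun t => gweight lam t *
   ((1 - 'X ^+ 2) * q^`() - (2 * lam + 1) *: ('X * q)).[t])) =
   (fun k => gweight (lam + 1) (exhaust k) * (q.[exhaust k] - q.[- exhaust k])).
  apply/funext => k; rewrite /Rintegral FTC_gweight ?exhaust_itv //= /gweight sqrrN.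
  by rewrite mulrBr.
rewrite -(mul0r (q.[1] - q.[-1])); apply: cvgM; first exact: gweightS_exhaust_cvg.
apply: cvgB; first exact: (cvg_comp _ _ exhaust_cvg (@continuous_horner R q 1)).
apply: (cvg_comp _ _ (cvgN exhaust_cvg) (@continuous_horner R q (-1))).
Qed.

Lemma gint1_gt0 (lam : R) : - 2^-1 < lam -> 0 < gint lam 1.
Proof.
(* On [-1/2, 1/2] the base 1 - t^2 lies in [3/4, 1]. Raising the exponent to [a] can only lower the
   weight, and since [a] is nonnegative the power is then at least (3/4)^a. *)
move=> hlam; pose a := Num.max 0 (lam - 2^-1).
pose c : R := (3 / 4) `^ a.
have c0 : 0 < c by apply: powR_gt0; lra.
have sub : `[- exhaust 0, exhaust 0] `<=` `]-1, 1[.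
  by move=> x /exhaust_sub /=; rewrite in_itv.
have i1 := integrable_gweightM 1 hlam.
have ic : mu.-integrable `[- exhaust 0, exhaust 0] (EFin \o (fun=> c)).
  by apply: integrable_exhaust => x x1; exact: derivable_cst.
apply: (@lt_le_trans _ _ (Rintegral mu `[- exhaust 0, exhaust 0] (fun=> c))).
  rewrite Rintegral_cst //= lebesgue_measure_itv /= lte_fin.
  by rewrite /exhaust; have -> : - (1 - 2^-1) < (1 - 2^-1) :> R; [lra|rewrite /= mulr_gt0 //; lra].
apply: (@le_trans _ _ (Rintegral mu `[- exhaust 0, exhaust 0] (fun t => gweight lam t * 1.[t]))).
  apply: le_Rintegral => //; first exact: integrableS i1.
  move=> x; rewrite /= in_itv /= /exhaust => /andP[x1 x2].
  rewrite hornerC mulr1 /gweight.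
  have h1 : 3 / 4 <= 1 - x ^+ 2 by nra.
  apply: (@le_trans _ _ ((1 - x ^+ 2) `^ a)).
    by rewrite /c; apply: ge0_ler_powR; rewrite ?nnegrE ?le_max ?lexx //; lra.
  have h : 0 < 1 - x ^+ 2 <= 1 by rewrite gerBl sqr_ge0 andbT; lra.
  have := @ger_powR R _ h (lam - 2^-1) a; apply; rewrite le_max lexx orbT //.
rewrite /gint /Rintegral fine_le //.
- by apply: integrable_fin_num => //; exact: integrableS i1.
- exact: integrable_fin_num.
- apply: ge0_subset_integral => //.
  + by case/integrableP: i1.
  + by move=> x _; rewrite lee_fin hornerC mulr1 gweight_ge0.
Qed.

End weight.

(** * Frobenius norm of a min-matrix *)

Section frobenius.
Variables (R : realFieldType) (S H : nat -> R).
Hypothesis H_gt0 : forall i, 0 < H i.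

(** This is tr(M^2) for M_ij = S_min(i,j) / sqrt(H_i H_j); squaring the entries removes the
    roots. *)
Definition frob m := \sum_(i < m) \sum_(j < m) S (minn i j) ^+ 2 / (H i * H j).

Lemma frob0 : frob 0 = 0. Proof. by rewrite /frob big_ord0. Qed.

(** The new row and the new column are equal, and their minima are the row index itself; the corner,
    counted twice, is subtracted once. *)
Lemma frobS m : frob m.+1 = frob m +
  (2 * (\sum_(i < m.+1) S i ^+ 2 / H i) - S m ^+ 2 / H m) / H m.
Proof.
rewrite /frob big_ord_recr /=.
under eq_bigr do rewrite big_ord_recr /=.
rewrite big_split /= -addrA; congr (_ + _).
rewrite !big_ord_recr /= minnn.
have E1 : \sum_(i < m) S (minn i m) ^+ 2 / (H i * H m) = (\sum_(i < m) S i ^+ 2 / H i) / H m.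
  rewrite mulr_suml; apply: eq_bigr => i _.
  by rewrite (minn_idPl (ltnW (ltn_ord i))) invfM mulrA.
have E2 : \sum_(i < m) S (minn m i) ^+ 2 / (H m * H i) = (\sum_(i < m) S i ^+ 2 / H i) / H m.
  by rewrite -E1; apply: eq_bigr => i _; rewrite minnC [H m * _]mulrC.
rewrite E1 E2; move: (\sum_(i < m) _) => X.
by have h := lt0r_neq0 (H_gt0 m); field.
Qed.

(** Cauchy-Schwarz: the largest eigenvalue of M is at most its Frobenius norm, here with B in place
    of the root of [frob m]. *)
Lemma quad_form_le_frob m (x : nat -> R) (B : R) : 0 < B -> frob m <= B ^+ 2 ->
  \sum_(i < m) \sum_(j < m) x i * x j * S (minn i j) <=
  B * \sum_(i < m) x i ^+ 2 * H i.
Proof.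
move=> B0 FB; set N := \sum_(i < m) x i ^+ 2 * H i.
have t0 i : 0 <= x i ^+ 2 * H i by rewrite mulr_ge0 ?sqr_ge0 // ltW.
have : 0 <= N by exact: sumr_ge0.
rewrite le_eqVlt => /predU1P[N0|N0].
  have x0 (i : 'I_m) : x i = 0.
    have /eqP := esym N0; rewrite psumr_eq0 // => /allP /(_ i (mem_index_enum _)) /=.
    by rewrite mulf_eq0 (gt_eqF (H_gt0 i)) orbF sqrf_eq0 => /eqP.
  rewrite -N0 mulr0 big1 // => i _; rewrite big1 // => j _.
  by rewrite x0 !mul0r.
(* AM-GM with weights B / N and N / B. *)
have amgm (i j : nat) : 2 * (x i * x j * S (minn i j)) <=
    B / N * ((x i ^+ 2 * H i) * (x j ^+ 2 * H j)) +
    N / B * (S (minn i j) ^+ 2 / (H i * H j)).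
  have hi := H_gt0 i; have hj := H_gt0 j; move: (S _) => s.
  rewrite -subr_ge0.
  have -> : B / N * ((x i ^+ 2 * H i) * (x j ^+ 2 * H j)) + N / B * (s ^+ 2 / (H i * H j))
     - 2 * (x i * x j * s) =
     (B * (x i * x j * H i * H j) - N * s) ^+ 2 / (B * N * (H i * H j)).
    by field; rewrite !lt0r_neq0.
  by rewrite divr_ge0 ?sqr_ge0 // ltW // !mulr_gt0.
have sum2 : 2 * (\sum_(i < m) \sum_(j < m) x i * x j * S (minn i j)) <=
    B / N * N ^+ 2 + N / B * frob m.
  rewrite mulr_sumr.
  have -> : B / N * N ^+ 2 + N / B * frob m = \sum_(i < m) \sum_(j < m)
    (B / N * ((x i ^+ 2 * H i) * (x j ^+ 2 * H j)) + N / B * (S (minn i j) ^+ 2 / (H i * H j))).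
    under [RHS]eq_bigr do rewrite big_split /=.
    rewrite big_split /= expr2 {3}/N; congr (_ + _).
      rewrite mulr_suml mulr_sumr; apply: eq_bigr => i _.
      by rewrite /N !mulr_sumr.
    by rewrite mulr_sumr; apply: eq_bigr => i _; rewrite mulr_sumr.
  by apply: ler_sum => i _; rewrite mulr_sumr; apply: ler_sum => j _; exact: amgm.
have h1 : B / N * N ^+ 2 = B * N by field; rewrite lt0r_neq0.
have h2 : N / B * frob m <= B * N.
  have -> : B * N = N / B * B ^+ 2 by field; rewrite lt0r_neq0.
  by rewrite ler_wpM2l // divr_ge0 // ltW.
lra.
Qed.

End frobenius.

(** * Increments of the traces and of the bounds *)

Section increments.
Variable R : realFieldType.
Implicit Types lam k : R.

Definition dg lam k := 2 * k * (k + lam) * (k + 2 * lam) / (2 * lam + 1).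

(* [vg k * h_k] is the closed form of the sum of [dg l ^+ 2 * h_l] over
   [1 <= l <= k] with [l] of the parity of [k]; the quadratic factor solves
   the telescoping equation. *)
Definition vg lam k :=
  2 * k * (k + lam) * (k + 2 * lam) * (k + 2 * lam + 1) * (k + 2 * lam + 2) *
  ((k + lam + 1) ^+ 2 -
    (2 * lam ^+ 3 + 7 * lam ^+ 2 + 8 * lam + 7) / (2 * lam + 3)) /
  ((2 * lam + 1) ^+ 2 * (2 * lam + 5)).

(** The square of the upper bound as a function of the degree. Its leading term k^8 / (4 (2 lam +
    1)^2 (2 lam + 5)) is that of tr(M^2), and also that of [lower] times the trace; hence the terms
    of degree 7 cancel in the step inequalities below. *)
Definition upper_sq lam k :=
  (k + 5 / 4 * lam + 9 / 8) ^+ 8 / (4 * (2 * lam + 1) ^+ 2 * (2 * lam + 5)).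

Definition lower lam k :=
  (k + 1) * (k + lam + 2^-1) ^+ 2 * (k + 2 * lam) / ((2 * lam + 1) * (2 * lam + 5)).

(* The trace of the class of [k]; [c] is the parity-dependent constant. *)
Definition trg lam c k :=
  ((k + lam + 1) ^+ 4 - 2 * (1 + lam ^+ 2) * (k + lam + 1) ^+ 2 + c) /
  (4 * (2 * lam + 1)).

Lemma trg_step lam c k : - 2^-1 < lam -> trg lam c k = trg lam c (k - 2) + dg lam k.
Proof.
by move=> l; rewrite /trg /dg; field; apply: lt0r_neq0; lra.
Qed.

Ltac poly_ge0 := repeat match goal with
  | |- is_true (0 <= _ + _) => apply: addr_ge0
  | |- is_true (0 <= _ * _) => apply: mulr_ge0
  | |- is_true (0 <= _ ^+ _) => apply: exprn_ge0
  | |- is_true (0 <= _^-1) => rewrite invr_ge0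
  end.

(* In [s] and [u] all coefficients of the difference are nonnegative. Large ones
   are written in base 100 because numerals in [R] are unary. *)
Lemma upper_step lam k : - 2^-1 < lam -> 1 <= k ->
  2 * vg lam k - dg lam k ^+ 2 <= upper_sq lam k - upper_sq lam (k - 2).
Proof.
move=> l k1.
pose s := k - 1; pose u := lam + 2^-1.
have s0 : 0 <= s by rewrite /s; lra.
have u0 : 0 < u by rewrite /u; lra.
have u0' := ltW u0.
have -> : k = s + 1 by rewrite /s; lra.
have -> : lam = u - 2^-1 by rewrite /u; lra.
clearbody s u; clear l k1; rewrite -subr_ge0.
rewrite [X in 0 <= X](_ : _ = (205 / 16 + (31 * 100 + 45) / 32 * u + (193 * 100 + 47) / 64 * u ^+ 2 +
    (626 * 100 + 97) / 128 * u ^+ 3 +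
    ((13 * 100 + 1) * 100 + 9) / 256 * u ^+ 4 +
    ((24 * 100 + 8) * 100 + 3) / 512 * u ^+ 5 +
    ((35 * 100) * 100 + 89) / (10 * 100 + 24) * u ^+ 6 +
    ((29 * 100 + 68) * 100 + 75) / (20 * 100 + 48) * u ^+ 7 +
    (781 * 100 + 25) / (20 * 100 + 48) * u ^+ 8 + 547 / 8 * s +
    837 / 2 * s * u + (314 * 100 + 53) / 32 * s * u ^+ 2 +
    (378 * 100 + 87) / 32 * s * u ^+ 3 +
    ((14 * 100 + 79) * 100 + 1) / 128 * s * u ^+ 4 +
    (643 * 100 + 19) / 64 * s * u ^+ 5 +
    ((30 * 100 + 63) * 100 + 39) / 512 * s * u ^+ 6 +
    ((10 * 100 + 93) * 100 + 75) / 512 * s * u ^+ 7 + 573 / 4 * s ^+ 2 +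
    (52 * 100 + 79) / 8 * s ^+ 2 * u + (43 * 100 + 9) / 4 * s ^+ 2 * u ^+ 2 +
    (174 * 100 + 51) / 16 * s ^+ 2 * u ^+ 3 +
    (652 * 100 + 45) / 64 * s ^+ 2 * u ^+ 4 +
    ((11 * 100 + 49) * 100 + 55) / 128 * s ^+ 2 * u ^+ 5 +
    (574 * 100 + 33) / 128 * s ^+ 2 * u ^+ 6 + 291 / 2 * s ^+ 3 +
    921 / 2 * s ^+ 3 * u + (22 * 100 + 65) / 4 * s ^+ 3 * u ^+ 2 +
    449 * s ^+ 3 * u ^+ 3 + (220 * 100 + 59) / 32 * s ^+ 3 * u ^+ 4 +
    (157 * 100 + 31) / 32 * s ^+ 3 * u ^+ 5 + 75 * s ^+ 4 +
    375 / 2 * s ^+ 4 * u + 355 / 4 * s ^+ 4 * u ^+ 2 +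
    (25 * 100 + 85) / 8 * s ^+ 4 * u ^+ 3 +
    (24 * 100 + 55) / 8 * s ^+ 4 * u ^+ 4 + 30 * s ^+ 5 + 8 * s ^+ 5 * u +
    193 / 2 * s ^+ 5 * u ^+ 2 + 205 / 2 * s ^+ 5 * u ^+ 3 + 14 * s ^+ 6 * u +
    14 * s ^+ 6 * u ^+ 2)
  / ((2 * u) ^+ 2 * (2 * u + 4) * (2 * u + 2))).
  apply: divr_ge0; last by do 2 (apply: mulr_ge0; last lra); exact: sqr_ge0.
  by poly_ge0; first [exact: s0 | exact: u0' | exact: ler01 | exact: ler0n].
by rewrite /upper_sq /vg /dg; field; repeat (apply/andP; split); apply: lt0r_neq0; lra.
Qed.

(** The lower bound is carried as [lower] times trace <= tr(M^2), without division, so that the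
    induction only compares increments. The even class starts at k = 2, whence the expansion in s =
    k - 2. *)
Lemma lower_step_even lam k : - 2^-1 < lam -> 2 <= k ->
  lower lam k * trg lam ((1 - lam ^+ 2) ^+ 2) k -
    lower lam (k - 2) * trg lam ((1 - lam ^+ 2) ^+ 2) (k - 2) <=
  2 * vg lam k - dg lam k ^+ 2.
Proof.
move=> l k1.
pose s := k - 2; pose u := lam + 2^-1.
have s0 : 0 <= s by rewrite /s; lra.
have u0 : 0 < u by rewrite /u; lra.
have u0' := ltW u0.
have -> : k = s + 2 by rewrite /s; lra.
have -> : lam = u - 2^-1 by rewrite /u; lra.
clearbody s u; clear l k1; rewrite -subr_ge0.
rewrite [X in 0 <= X](_ : _ = (144 + (10 * 100 + 8) * u + (27 * 100 + 80) * u ^+ 2 +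
    (38 * 100 + 60) * u ^+ 3 + (28 * 100 + 56) * u ^+ 4 +
    (10 * 100 + 72) * u ^+ 5 + 160 * u ^+ 6 + 564 * s +
    (34 * 100 + 32) * s * u + (79 * 100 + 54) * s * u ^+ 2 +
    (89 * 100 + 18) * s * u ^+ 3 + (51 * 100 + 36) * s * u ^+ 4 +
    (14 * 100 + 48) * s * u ^+ 5 + 160 * s * u ^+ 6 + 902 * s ^+ 2 +
    (46 * 100 + 88) * s ^+ 2 * u + (87 * 100 + 94) * s ^+ 2 * u ^+ 2 +
    (75 * 100 + 82) * s ^+ 2 * u ^+ 3 + (31 * 100 + 90) * s ^+ 2 * u ^+ 4 +
    616 * s ^+ 2 * u ^+ 5 + 40 * s ^+ 2 * u ^+ 6 + 768 * s ^+ 3 +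
    (32 * 100 + 96) * s ^+ 3 * u + (47 * 100 + 4) * s ^+ 3 * u ^+ 2 +
    (28 * 100 + 64) * s ^+ 3 * u ^+ 3 + 768 * s ^+ 3 * u ^+ 4 +
    80 * s ^+ 3 * u ^+ 5 + 380 * s ^+ 4 + (12 * 100 + 50) * s ^+ 4 * u +
    (12 * 100 + 10) * s ^+ 4 * u ^+ 2 + 430 * s ^+ 4 * u ^+ 3 +
    50 * s ^+ 4 * u ^+ 4 + 108 * s ^+ 5 + 232 * s ^+ 5 * u +
    118 * s ^+ 5 * u ^+ 2 + 10 * s ^+ 5 * u ^+ 3 + 14 * s ^+ 6 + 14 * s ^+ 6 * u)
  / ((2 * u) ^+ 2 * (2 * u + 4) * (2 * u + 2))).
  apply: divr_ge0; last by do 2 (apply: mulr_ge0; last lra); exact: sqr_ge0.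
  by poly_ge0; first [exact: s0 | exact: u0' | exact: ler01 | exact: ler0n].
by rewrite /lower /trg /vg /dg; field; repeat (apply/andP; split); apply: lt0r_neq0; lra.
Qed.

Lemma lower_step_odd lam k : - 2^-1 < lam -> 1 <= k ->
  lower lam k * trg lam (lam ^+ 4 + 2 * lam ^+ 2) k -
    lower lam (k - 2) * trg lam (lam ^+ 4 + 2 * lam ^+ 2) (k - 2) <=
  2 * vg lam k - dg lam k ^+ 2.
Proof.
move=> l k1.
pose s := k - 1; pose u := lam + 2^-1.
have s0 : 0 <= s by rewrite /s; lra.
have u0 : 0 < u by rewrite /u; lra.
have u0' := ltW u0.
have -> : k = s + 1 by rewrite /s; lra.
have -> : lam = u - 2^-1 by rewrite /u; lra.
clearbody s u; clear l k1; rewrite -subr_ge0.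
rewrite [X in 0 <= X](_ : _ = (16 * u ^+ 2 + 96 * u ^+ 3 + 192 * u ^+ 4 + 144 * u ^+ 5 + 32 * u ^+ 6 +
    28 * s * u + 244 * s * u ^+ 2 + 708 * s * u ^+ 3 + 844 * s * u ^+ 4 +
    416 * s * u ^+ 5 + 80 * s * u ^+ 6 + 8 * s ^+ 2 + 190 * s ^+ 2 * u +
    810 * s ^+ 2 * u ^+ 2 + (14 * 100 + 70) * s ^+ 2 * u ^+ 3 +
    (11 * 100 + 38) * s ^+ 2 * u ^+ 4 + 376 * s ^+ 2 * u ^+ 5 +
    40 * s ^+ 2 * u ^+ 6 + 48 * s ^+ 3 + 352 * s ^+ 3 * u +
    (10 * 100 + 44) * s ^+ 3 * u ^+ 2 + (12 * 100 + 28) * s ^+ 3 * u ^+ 3 +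
    568 * s ^+ 3 * u ^+ 4 + 80 * s ^+ 3 * u ^+ 5 + 50 * s ^+ 4 +
    300 * s ^+ 4 * u + 620 * s ^+ 4 * u ^+ 2 + 380 * s ^+ 4 * u ^+ 3 +
    50 * s ^+ 4 * u ^+ 4 + 24 * s ^+ 5 + 148 * s ^+ 5 * u +
    118 * s ^+ 5 * u ^+ 2 + 10 * s ^+ 5 * u ^+ 3 + 14 * s ^+ 6 + 14 * s ^+ 6 * u)
  / ((2 * u) ^+ 2 * (2 * u + 4) * (2 * u + 2))).
  apply: divr_ge0; last by do 2 (apply: mulr_ge0; last lra); exact: sqr_ge0.
  by poly_ge0; first [exact: s0 | exact: u0' | exact: ler01 | exact: ler0n].
by rewrite /lower /trg /vg /dg; field; repeat (apply/andP; split); apply: lt0r_neq0; lra.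
Qed.

End increments.

(** * Gegenbauer polynomials *)

Section gegenbauer_poly.
Variables (R : realFieldType) (lam : R).

Definition geg_coef (k : nat) : R := if k is 0 then 1 else k%:R + 2 * lam.

(* [geg k] is the classical [C_k / (2 lam)] for [k >= 1], and [geg 0 = 1]; this
   normalisation makes sense at [lam = 0] and keeps [geg_pair] free of
   divisions by [lam], at the price of the exceptional value [geg_coef 0]. *)
Fixpoint geg_pair (n : nat) : {poly R} * {poly R} :=
  if n is k.+1 then
    let: (p, q) := geg_pair k in
    (q, (k.+2%:R^-1)%:P *
        (2 * (k.+1%:R + lam%:P) * 'X * q - (geg_coef k)%:P * p))
  else (1, 'X).

Definition geg n := (geg_pair n).1.

Lemma geg0 : geg 0 = 1. Proof. by []. Qed.
Lemma geg1 : geg 1 = 'X. Proof. by []. Qed.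

Lemma gegS n : (geg_pair n).2 = geg n.+1.
Proof. by rewrite /geg /=; case: (geg_pair n). Qed.

Lemma geg_recE k : geg k.+2 = (k.+2%:R^-1)%:P *
  (2 * (k.+1%:R + lam%:P) * 'X * geg k.+1 - (geg_coef k)%:P * geg k).
Proof.
by rewrite -gegS /geg /=; case: (geg_pair k).
Qed.

Lemma polyC_natr_neq0 k : (k.+1%:R : {poly R}) != 0.
Proof. by rewrite -polyC_natr polyC_eq0 pnatr_eq0. Qed.

Lemma polyC_rec k :
  2 * (k.+1%:R + lam%:P) = (2 * (k.+1%:R + lam))%:P :> {poly R}.
Proof. by rewrite polyCM polyC_natr polyCD polyC_natr. Qed.

Lemma geg_rec k : k.+2%:R * geg k.+2 =
  2 * (k.+1%:R + lam%:P) * 'X * geg k.+1 - (geg_coef k)%:P * geg k.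
Proof.
have nz : (k.+2%:R : R) != 0 by rewrite pnatr_eq0.
by rewrite geg_recE mulrA -[X in X * _ * _]polyC_natr -polyCM (mulfV nz) mul1r.
Qed.

(** Under a derivative the exceptional value [geg_coef 0] disappears, because [geg 0] is constant;
    the uniform formula then serves for all [k]. *)
Lemma geg_coef_deriv k :
  (geg_coef k)%:P * (geg k)^`() = (k%:R + 2 * lam%:P) * (geg k)^`().
Proof.
case: k => [|k]; first by rewrite geg0 derivC !mulr0.
by rewrite /geg_coef polyCD polyCM !polyC_natr.
Qed.

(** The two classical first-order relations, proved jointly: the induction step differentiates the
    recurrence and eliminates the derivative of [geg k] by the second relation. *)
Lemma deriv_geg_identities k :
  (geg k.+1)^`() = 'X * (geg k)^`() + (geg_coef k)%:P * geg k /\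
  'X * (geg k.+1)^`() - (geg k)^`() = k.+1%:R * geg k.+1.
Proof.
elim: k => [|k [IH1 IH2]].
  by rewrite geg1 geg0 derivX derivC /=; split; ring.
have rec := geg_rec k.
have drec : k.+2%:R * (geg k.+2)^`() =
    2 * (k.+1%:R + lam%:P) * (geg k.+1 + 'X * (geg k.+1)^`())
    - (k%:R + 2 * lam%:P) * (geg k)^`().
  have := congr1 (@deriv R) rec.
  rewrite derivB -!polyC_natr -!polyCD -!polyCM -mulrA.
  rewrite !(derivM, derivC, derivX) !mul0r !add0r geg_coef_deriv mul1r => ->.
  by rewrite !polyCM !polyCD !polyC_natr; ring.
have c1 : (geg_coef k.+1)%:P = k.+1%:R + 2 * lam%:P :> {poly R}.
  by rewrite /geg_coef polyCD polyCM !polyC_natr.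
have S1 : (geg k.+2)^`() = 'X * (geg k.+1)^`() + (geg_coef k.+1)%:P * geg k.+1.
  apply: (mulfI (polyC_natr_neq0 k.+1)); rewrite drec c1.
  have -> : (geg k)^`() = 'X * (geg k.+1)^`() - k.+1%:R * geg k.+1.
    by rewrite -IH2; ring.
  ring.
split => //.
rewrite rec S1 c1.
have -> : (geg_coef k)%:P * geg k = (geg k.+1)^`() - 'X * (geg k)^`().
  by rewrite IH1; ring.
have -> : (geg k)^`() = 'X * (geg k.+1)^`() - k.+1%:R * geg k.+1.
  by rewrite -IH2; ring.
ring.
Qed.

(** The coefficient added depends only on the new index, so the expansion of each derivative extends
    that of the previous one of its parity. This is the source of the min-structure of the Gram
    matrix. *)
Lemma deriv_gegSS k : (geg k.+2)^`() =
  (geg k)^`() + (2 * (k.+1%:R + lam))%:P * geg k.+1.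
Proof.
have [_ h2] := deriv_geg_identities k; have [h3 _] := deriv_geg_identities k.+1.
rewrite h3 /geg_coef !(polyCD, polyCM, polyC_natr).
have -> : (geg k)^`() = 'X * (geg k.+1)^`() - k.+1%:R * geg k.+1.
  by rewrite -h2; ring.
ring.
Qed.

Lemma geg_ode k :
  (1 - 'X^2) * (geg k)^`()^`() - (2 * lam + 1) *: ('X * (geg k)^`()) =
  - (k%:R * (k%:R + 2 * lam)) *: geg k.
Proof.
case: k => [|k].
  by rewrite geg0 derivC deriv0 !(mulr0, mulr0n, mul0r, oppr0, scale0r, scaler0, subr0).
have [h1 h2] := deriv_geg_identities k.
have h3 : (geg k)^`() = 'X * (geg k.+1)^`() - k.+1%:R * geg k.+1 by rewrite -h2; ring.
have h4 : (1 - 'X^2) * (geg k.+1)^`() =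
    (geg_coef k)%:P * geg k - k.+1%:R * ('X * geg k.+1).
  have -> : (geg_coef k)%:P * geg k = (geg k.+1)^`() - 'X * (geg k)^`() by rewrite h1; ring.
  rewrite h3; ring.
have h5 : (1 - 'X^2) * (geg k.+1)^`()^`() =
    2 * 'X * (geg k.+1)^`() + (k%:R + 2 * lam%:P) * ('X * (geg k.+1)^`() - k.+1%:R * geg k.+1)
    - k.+1%:R * (geg k.+1 + 'X * (geg k.+1)^`()).
  have := congr1 (@deriv R) h4.
  rewrite -polyC_natr -[1]polyC1 !(derivM, derivB, derivC, derivX, derivXn) /=.
  rewrite !mul0r !add0r geg_coef_deriv h3 polyC_natr => /(congr1 (fun p => p + 2 * 'X * (geg k.+1)^`())) h.
  rewrite (_ : (1%:P - 'X^2) * (geg k.+1)^`()^`() = 'X^1 *- 2 * (geg k.+1)^`() +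
     (1%:P - 'X^2) * (geg k.+1)^`()^`() + 2 * 'X * (geg k.+1)^`()); last by ring.
  rewrite h; ring.
rewrite h5 -!mul_polyC !(polyCN, polyCD, polyCM, polyC_natr, polyC1); ring.
Qed.

Hypothesis hlam : - 2^-1 < lam.

Lemma natrS_lam_gt0 k : 0 < k.+1%:R + lam.
Proof. have hl := hlam. by have k0 : 0 <= k%:R :> R := ler0n R k; lra. Qed.

Lemma size_geg k : size (geg k) = k.+1.
Proof.
have hl := hlam.
suff: size (geg k) = k.+1 /\ size (geg k.+1) = k.+2 by case.
elim: k => [|k [IH1 IH2]]; first by rewrite geg0 geg1 size_poly1 size_polyX.
split => //; rewrite geg_recE size_Cmul ?invr_eq0 ?pnatr_eq0 //.
rewrite polyC_rec.
have s1 : size ((2 * (k.+1%:R + lam))%:P * 'X * geg k.+1) = k.+3.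
  rewrite -mulrA size_Cmul; last by have := natrS_lam_gt0 k => h; apply: lt0r_neq0; lra.
  by rewrite mulrC size_mulX ?IH2 // -size_poly_eq0 IH2.
rewrite size_polyDl s1 // size_polyN mul_polyC.
by apply: (leq_ltn_trans (size_scale_leq _ _)); rewrite IH1.
Qed.

(** [geg k] has degree exactly [k], so the top coefficient can be removed one degree at a time. *)
Lemma geg_span n (p : {poly R}) : (size p <= n)%N ->
  exists c : nat -> R, p = \sum_(k < n) c k *: geg k.
Proof.
elim: n p => [|n IH] p.
  rewrite leqn0 size_poly_eq0 => /eqP ->; exists (fun=> 0); by rewrite big_ord0.
move=> sp.
have gn : (geg n)`_n != 0.
  by rewrite -[X in _`_X]/(n.+1.-1) -(size_geg n) -/(lead_coef _) lead_coef_eq0 -size_poly_eq0 size_geg.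
pose a := p`_n / (geg n)`_n.
have [|c cE] := IH (p - a *: geg n).
  apply/leq_sizeP => j; rewrite leq_eqVlt => /predU1P[<-|nj].
    by rewrite coefB coefZ divfK // subrr.
  by rewrite coefB coefZ !nth_default ?mulr0 ?subr0 ?size_geg // (leq_trans sp).
exists (fun k => if (k == n)%N then a else c k).
rewrite big_ord_recr /= eqxx -[LHS](subrK (a *: geg n)) cE; congr (_ + _).
by apply: eq_bigr => i _; rewrite ltn_eqF.
Qed.

(** * Orthogonality and norms for an abstract functional *)

Variable I : {poly R} -> R.
Hypothesis ID : forall p q, I (p + q) = I p + I q.
Hypothesis IZ : forall c p, I (c *: p) = c * I p.
Hypothesis I_by_parts : forall q,
  I ((1 - 'X^2) * q^`() - (2 * lam + 1) *: ('X * q)) = 0.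
Hypothesis I1_gt0 : 0 < I 1.

Let I0 : I 0 = 0. Proof. by rewrite -(scale0r 0) IZ mul0r. Qed.

Let IN p : I (- p) = - I p. Proof. by rewrite -scaleN1r IZ mulN1r. Qed.

Let IB p q : I (p - q) = I p - I q. Proof. by rewrite ID IN. Qed.

Let I_sum n (F : nat -> {poly R}) : I (\sum_(i < n) F i) = \sum_(i < n) I (F i).
Proof.
by elim: n => [|n IH]; rewrite ?big_ord0 ?I0 // !big_ord_recr /= ID IH.
Qed.

Lemma I_sum_bilin m n (x y : nat -> R) (u v : nat -> {poly R}) :
  I ((\sum_(i < m) x i *: u i) * (\sum_(j < n) y j *: v j)) =
  \sum_(i < m) \sum_(j < n) x i * y j * I (u i * v j).
Proof.
rewrite mulr_suml (I_sum _ (fun i => (x i *: u i) * (\sum_(j < n) y j *: v j))).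
apply: eq_bigr => i _.
rewrite mulr_sumr (I_sum _ (fun j => (x i *: u i) * (y j *: v j))).
by apply: eq_bigr => j _; rewrite -scalerAl -scalerAr !IZ mulrA.
Qed.

Let gop (p : {poly R}) := (1 - 'X^2) * p^`()^`() - (2 * lam + 1) *: ('X * p^`()).

Let gop_sym p q : I (gop p * q) = I (gop q * p).
Proof.
(* Self-adjointness: the right-hand side is symmetric in [u] and [v], and the formula is
   [I_by_parts] applied to u' v. *)
suff h u v : I (gop u * v) = - I ((1 - 'X^2) * (u^`() * v^`())).
  by rewrite !h [q^`() * _]mulrC.
apply/eqP; rewrite -addr_eq0 -ID; apply/eqP.
rewrite -[RHS](I_by_parts (u^`() * v)); congr I.
by rewrite /gop derivM -!mul_polyC; ring.
Qed.

(** Eigenvectors of the symmetric operator [gop] for distinct eigenvalues: these differ by (k - j)(k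
    + j + 2 lam), where j + k >= 1 > - 2 lam. *)
Lemma geg_orth j k : j != k -> I (geg j * geg k) = 0.
Proof.
have hl := hlam.
move=> jk; have := gop_sym (geg j) (geg k).
rewrite /gop !geg_ode -!scalerAl !IZ [geg k * _]mulrC => /eqP.
rewrite -subr_eq0 -mulrBl mulf_eq0 => /orP[|/eqP //].
have -> : - (j%:R * (j%:R + 2 * lam)) - - (k%:R * (k%:R + 2 * lam)) =
  (k%:R - j%:R) * (k%:R + j%:R + 2 * lam) :> R by ring.
rewrite mulf_eq0 subr_eq0 eqr_nat eq_sym (negbTE jk) /= => /eqP h.
have : (1 <= j + k)%N by case: j k jk h => [|j] [|k].
by rewrite -(ler_nat R) natrD; lra.
Qed.

Definition geg_nrm k := I (geg k * geg k).

Lemma geg_nrm_rec k :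
  2 * (k.+1%:R + lam) * I ('X * geg k.+1 * geg k) = geg_coef k * geg_nrm k.
Proof.
have h := geg_rec k; have : I (k.+2%:R * geg k.+2 * geg k) = 0.
  rewrite -polyC_natr mul_polyC -scalerAl IZ geg_orth ?mulr0 //.
  by rewrite neq_ltn ltnS leqnSn orbT.
rewrite h polyC_rec.
rewrite mulrBl -!mulrA !mul_polyC IB !IZ !mulrA => /eqP.
by rewrite subr_eq0 => /eqP.
Qed.

Lemma geg_nrm1 : 2 * (1 + lam) * geg_nrm 1 = geg_nrm 0.
Proof.
have := geg_nrm_rec 0; rewrite /geg_coef mul1r => <-.
by rewrite /geg_nrm geg0 geg1 mulr1.
Qed.

(** Pair the recurrence with [geg k.+2], then eliminate the remaining moment of
    ['X * geg k.+2 * geg k.+1] by [geg_nrm_rec]. The ratio of the first two norms is separate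
    ([geg_nrm1]) because of [geg_coef 0]. *)
Lemma geg_nrmS k : k.+2%:R * (k.+2%:R + lam) * geg_nrm k.+2 =
  (k.+1%:R + lam) * (k.+1%:R + 2 * lam) * geg_nrm k.+1.
Proof.
have o : I ((geg_coef k)%:P * geg k * geg k.+2) = 0.
  rewrite -mulrA mul_polyC IZ geg_orth ?mulr0 //.
  by rewrite neq_ltn ltnS leqnSn.
have h1 : k.+2%:R * geg_nrm k.+2 = 2 * (k.+1%:R + lam) * I ('X * geg k.+2 * geg k.+1).
  rewrite -IZ /geg_nrm -IZ -!mul_polyC !mulrA polyC_natr geg_rec.
  rewrite polyC_rec.
  rewrite mulrBl IB o subr0; congr I; ring.
have := geg_nrm_rec k.+1; rewrite /geg_coef => h2.
rewrite [RHS](_ : _ = (k.+1%:R + lam) * ((k.+1%:R + 2 * lam) * geg_nrm k.+1)); last by ring.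
rewrite -h2 [LHS](_ : _ = (k.+2%:R + lam) * (k.+2%:R * geg_nrm k.+2)); last by ring.
by rewrite h1; ring.
Qed.

Lemma geg_nrm_gt0 k : 0 < geg_nrm k.
Proof.
have hl := hlam.
have n0 : 0 < geg_nrm 0 by rewrite /geg_nrm geg0 mulr1.
case: k => // k; elim: k => [|k IH].
  have h := geg_nrm1; rewrite -h pmulr_rgt0 // in n0; lra.
have a1 := natrS_lam_gt0 k; have a2 := natrS_lam_gt0 k.+1.
have a3 : 0 < k.+1%:R + 2 * lam by have k0 : 0 <= k%:R :> R := ler0n R k; lra.
have : 0 < k.+2%:R * (k.+2%:R + lam) * geg_nrm k.+2 by rewrite geg_nrmS !mulr_gt0.
by rewrite pmulr_rgt0 // mulr_gt0 // ltr0n.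
Qed.

Lemma deriv_geg_orth k j : (k <= j)%N || (odd k == odd j) -> I ((geg k)^`() * geg j) = 0.
Proof.
suff : (forall j, (k <= j)%N || (odd k == odd j) -> I ((geg k)^`() * geg j) = 0) /\
       (forall j, (k.+1 <= j)%N || (odd k.+1 == odd j) -> I ((geg k.+1)^`() * geg j) = 0).
  by case=> h _; exact: h.
elim: k {j} => [|k [IH1 IH2]].
  split=> j; first by rewrite geg0 derivC mul0r I0.
  by rewrite geg1 derivX -geg0 => h; apply: geg_orth; case: j h.
split=> // j h; rewrite deriv_gegSS mulrDl -mulrA mul_polyC ID IZ IH1 ?add0r.
  rewrite geg_orth ?mulr0 //; apply/negP => /eqP jE; move: h; rewrite -jE ltnn /=.
  by rewrite /= negbK; case: (odd k).
case/orP: h => [h|]; first by rewrite (leq_trans _ h) // leqW.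
by rewrite /= negbK => ->; rewrite orbT.
Qed.

Definition dgeg_nrm k := I ((geg k)^`() * (geg k)^`()).

(** The derivatives of [geg (k + i.*2)] and [geg k] differ by multiples of [geg j] with j > k, all
    orthogonal to the derivative of [geg k]. *)
Lemma dgeg_gram k i : I ((geg k)^`() * (geg (k + i.*2))^`()) = dgeg_nrm k.
Proof.
elim: i => [|i IH]; first by rewrite addn0.
rewrite doubleS !addnS deriv_gegSS mulrDr ID IH mulrCA mul_polyC IZ deriv_geg_orth ?mulr0 ?addr0 //.
by rewrite leqW // leq_addr.
Qed.

Lemma dgeg_orth k j : odd k != odd j -> I ((geg k)^`() * (geg j)^`()) = 0.
Proof.
suff : (odd k != odd j -> I ((geg k)^`() * (geg j)^`()) = 0) /\
  (odd k != odd j.+1 -> I ((geg k)^`() * (geg j.+1)^`()) = 0) by case.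
elim: j => [|j [IH1 IH2]].
  split; first by rewrite geg0 derivC mulr0 I0.
  by move=> h; rewrite geg1 derivX -geg0 deriv_geg_orth //; case: (odd k) h; rewrite ?orbT.
split=> // h; rewrite deriv_gegSS mulrDr mulrCA mul_polyC ID IZ IH1 ?deriv_geg_orth ?mulr0 ?addr0 //.
  by move: h => /=; case: (odd k); case: (odd j); rewrite ?orbT.
by move: h; rewrite /= negbK.
Qed.

Lemma dgeg_nrmSS k : dgeg_nrm k.+2 =
  dgeg_nrm k + (2 * (k.+1%:R + lam)) ^+ 2 * geg_nrm k.+1.
Proof.
rewrite /dgeg_nrm deriv_gegSS mul_polyC.
have E (c : R) (p q : {poly R}) : (p + c *: q) * (p + c *: q) =
    p * p + (2 * c) *: (p * q) + c ^+ 2 *: (q * q).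
  by rewrite -!mul_polyC polyCM polyC_exp polyC_natr; ring.
by rewrite E !ID !IZ deriv_geg_orth ?leqnSn // mulr0 addr0.
Qed.

Lemma geg_nrmSE k : geg_nrm k.+2 =
  (k.+1%:R + lam) * (k.+1%:R + 2 * lam) / (k.+2%:R * (k.+2%:R + lam)) * geg_nrm k.+1.
Proof.
have hl := hlam.
have a2 := natrS_lam_gt0 k.+1.
have h := geg_nrmS k; apply: (mulfI (_ : k.+2%:R * (k.+2%:R + lam) != 0)).
  by rewrite mulf_neq0 ?pnatr_eq0 ?lt0r_neq0.
rewrite h; field.
by apply/andP; split; apply: lt0r_neq0; have k0 : 0 <= k%:R :> R := ler0n R k; lra.
Qed.

Lemma dgeg_nrmE k : dgeg_nrm k.+1 = dg lam k.+1%:R * geg_nrm k.+1.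
Proof.
have hl := hlam.
have l1 : 2 * lam + 1 != 0 by apply: lt0r_neq0; lra.
have l2 : 1 + lam != 0 by apply: lt0r_neq0; lra.
have l3 : 2 + lam != 0 by apply: lt0r_neq0; lra.
have d1 : dgeg_nrm 1 = dg lam 1 * geg_nrm 1.
  rewrite /dgeg_nrm geg1 derivX -geg0 -/(geg_nrm 0) -geg_nrm1 /dg; field.
  exact: l1.
suff : dgeg_nrm k.+1 = dg lam k.+1%:R * geg_nrm k.+1 /\
       dgeg_nrm k.+2 = dg lam k.+2%:R * geg_nrm k.+2 by case.
elim: k => [|k [IH1 IH2]].
  split=> //; rewrite dgeg_nrmSS /dgeg_nrm geg0 derivC mul0r I0 add0r geg_nrmSE /dg; field.
  by rewrite l1 l3.
split=> //; rewrite dgeg_nrmSS IH1 !geg_nrmSE /dg.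
have := ler0n R k; rewrite -!natr1; move: (k%:R : R) => x; move=> x0'; have x0 : 0 <= x := x0'; field.
by repeat (apply/andP; split); apply: lt0r_neq0; lra.
Qed.

(** * Parity classes and their traces *)

Variable b : bool.

(** Degrees 1, 3, 5, ... for [b = false] and 2, 4, 6, ... for [b = true]. Degree 0 is in neither
    class, as its derivative vanishes. *)
Definition cls (i : nat) : nat := (b + i.*2).+1.
Definition cls_nrm i := geg_nrm (cls i).
Definition cls_dnrm i := dgeg_nrm (cls i).

Lemma clsS i : cls i.+1 = (cls i).+2.
Proof. by rewrite /cls doubleS !addnS. Qed.

Lemma cls_natr i : (cls i)%:R = b%:R + 2 * i%:R + 1 :> R.
Proof. by rewrite /cls -natr1 natrD -mul2n natrM. Qed.

Lemma cls_ge1 i : 1 <= b%:R + 2 * i%:R + 1 :> R.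
Proof. by rewrite -cls_natr ler1n. Qed.

Lemma cls_nrm_gt0 i : 0 < cls_nrm i. Proof. exact: geg_nrm_gt0. Qed.

Lemma cls_dnrmE i : cls_dnrm i = dg lam (b%:R + 2 * i%:R + 1) * cls_nrm i.
Proof. by rewrite /cls_dnrm /cls dgeg_nrmE -/(cls i) cls_natr. Qed.

Lemma dg_gt0 k : 1 <= k -> 0 < dg lam k.
Proof.
move=> k1; have hl := hlam.
by rewrite /dg divr_gt0 // ?mulr_gt0 //; lra.
Qed.

Lemma cls_dnrm_gt0 i : 0 < cls_dnrm i.
Proof. by rewrite cls_dnrmE mulr_gt0 ?cls_nrm_gt0 // dg_gt0 // cls_ge1. Qed.

Lemma cls_gram i j :
  I ((geg (cls i))^`() * (geg (cls j))^`()) = cls_dnrm (minn i j).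
Proof.
wlog ij : i j / (i <= j)%N.
  by move=> h; case/orP: (leq_total i j) => /h //; rewrite mulrC minnC.
rewrite (minn_idPl ij) /cls_dnrm -(dgeg_gram (cls i) (j - i)); congr (I (_ * (geg _)^`())).
by rewrite /cls addSn -addnA -doubleD subnKC.
Qed.

Lemma cls_nrmS i : cls_nrm i.+1 = let k := b%:R + 2 * i%:R + 1 in
  (k + lam) * (k + 2 * lam) * (k + 1 + 2 * lam) / ((k + 1) * (k + 2) * (k + 2 + lam)) * cls_nrm i.
Proof.
rewrite /cls_nrm clsS /= -cls_natr /cls !geg_nrmSE.
have hl := hlam; have := ler0n R (b + i.*2); rewrite -!natr1.
move: ((b + i.*2)%:R : R) => x x0'; have x0 : 0 <= x := x0'; field.
by repeat (apply/andP; split); apply: lt0r_neq0; lra.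
Qed.

Lemma sum_dnrm_sqr m :
  \sum_(i < m.+1) cls_dnrm i ^+ 2 / cls_nrm i = vg lam (b%:R + 2 * m%:R + 1) * cls_nrm m.
Proof.
have hl := hlam.
have E i : cls_dnrm i ^+ 2 / cls_nrm i = dg lam (b%:R + 2 * i%:R + 1) ^+ 2 * cls_nrm i.
  by rewrite cls_dnrmE; have h := lt0r_neq0 (cls_nrm_gt0 i); field.
elim: m => [|m IH].
  rewrite big_ord_recr big_ord0 /= add0r E; congr (_ * _); rewrite mulr0 addr0.
  by case: b => /=; rewrite /dg /vg; field; repeat (apply/andP; split); apply: lt0r_neq0; lra.
rewrite big_ord_recr /= IH E cls_nrmS /=.
have k1 := cls_ge1 m.
have -> : b%:R + 2 * m.+1%:R + 1 = (b%:R + 2 * m%:R + 1) + 2 :> R by rewrite -natr1; ring.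
move: (b%:R + _ + 1) k1 => k k1'; have k1 : 1 <= k := k1'.
by rewrite /dg /vg; field; repeat (apply/andP; split); apply: lt0r_neq0; lra.
Qed.

(** The norms cancel: the increment is a rational function of the degree and lam alone, which
    reduces both bounds to the step inequalities. *)
Lemma frob_step m (k := b%:R + 2 * m%:R + 1) :
  frob cls_dnrm cls_nrm m.+1 = frob cls_dnrm cls_nrm m + (2 * vg lam k - dg lam k ^+ 2).
Proof.
rewrite (frobS _ cls_nrm_gt0) sum_dnrm_sqr cls_dnrmE -/k; congr (_ + _).
by have h := lt0r_neq0 (cls_nrm_gt0 m); field.
Qed.

Lemma frob_le_upper_sq m : frob cls_dnrm cls_nrm m <= upper_sq lam (b%:R + 2 * m%:R - 1).
Proof.
have hl := hlam; elim: m => [|m IH].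
  (* For the odd class this is the value at k = -1, where k + 5/4 lam + 9/8 can be negative; the
     even exponent settles the sign. *)
  rewrite frob0 /upper_sq; apply: divr_ge0; first by rewrite exprn_even_ge0.
  by apply: mulr_ge0; [rewrite mulr_ge0 ?sqr_ge0 | lra].
rewrite frob_step; have := upper_step hlam (cls_ge1 m).
have -> : b%:R + 2 * m.+1%:R - 1 = b%:R + 2 * m%:R + 1 :> R by rewrite -natr1; ring.
have -> : b%:R + 2 * m%:R + 1 - 2 = b%:R + 2 * m%:R - 1 :> R by ring.
by move: IH; lra.
Qed.

(** Chosen so that [trg] vanishes one step before the class begins, at k = 0 for even and k = -1 for
    odd degrees. *)
Let trc : R := if b then (1 - lam ^+ 2) ^+ 2 else lam ^+ 4 + 2 * lam ^+ 2.

Let trg_base : trg lam trc (b%:R - 1) = 0.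
Proof.
have hl := hlam; rewrite /trg /trc.
by case: b => /=; field; repeat (apply/andP; split); apply: lt0r_neq0; lra.
Qed.

Lemma trace_dnrm m :
  \sum_(i < m) cls_dnrm i / cls_nrm i = trg lam trc (b%:R + 2 * m%:R - 1).
Proof.
elim: m => [|m IH]; first by rewrite big_ord0 mulr0 addr0 trg_base.
rewrite big_ord_recr /= IH cls_dnrmE mulfK ?lt0r_neq0 ?cls_nrm_gt0 //.
have -> : b%:R + 2 * m.+1%:R - 1 = b%:R + 2 * m%:R + 1 :> R by rewrite -natr1; ring.
rewrite [RHS]trg_step //; congr (trg _ _ _ + _); ring.
Qed.

Lemma frob_ge_lower m (k := b%:R + 2 * m%:R - 1) :
  lower lam k * (\sum_(i < m) cls_dnrm i / cls_nrm i) <= frob cls_dnrm cls_nrm m.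
Proof.
rewrite {}/k; elim: m => [|m IH]; first by rewrite big_ord0 mulr0 frob0.
rewrite frob_step; move: IH; rewrite !trace_dnrm.
have -> : b%:R + 2 * m.+1%:R - 1 = b%:R + 2 * m%:R + 1 :> R by rewrite -natr1; ring.
set k := b%:R + 2 * m%:R + 1.
have -> : b%:R + 2 * m%:R - 1 = k - 2 :> R by rewrite /k; ring.
have : lower lam k * trg lam trc k - lower lam (k - 2) * trg lam trc (k - 2) <=
  2 * vg lam k - dg lam k ^+ 2.
  rewrite /trc /k; have := cls_ge1 m; case: b => /= k1.
    by apply: lower_step_even => //; have := ler0n R m => m0; lra.
  exact: lower_step_odd.
lra.
Qed.

Lemma cls_inj i j : cls i = cls j -> i = j.
Proof. by move=> [] /addnI /double_inj. Qed.

Lemma cls_quad m (x : nat -> R) (p := \sum_(i < m) x i *: geg (cls i)) :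
  I (p * p) = \sum_(i < m) x i ^+ 2 * cls_nrm i /\
  I (p^`() * p^`()) = \sum_(i < m) \sum_(j < m) x i * x j * cls_dnrm (minn i j).
Proof.
have dE : p^`() = \sum_(i < m) x i *: (geg (cls i))^`().
  by rewrite /p raddf_sum; apply: eq_bigr => i _; rewrite /= derivZ.
split.
  rewrite /p (I_sum_bilin m m x x (fun i => geg (cls i)) (fun i => geg (cls i))).
  apply: eq_bigr => i _; rewrite (bigD1 i) //= big1 ?addr0 -?expr2 // => j ji.
  by rewrite geg_orth ?mulr0 //; apply: contraNneq ji => /cls_inj ij; apply/eqP/val_inj.
rewrite dE (I_sum_bilin m m x x (fun i => (geg (cls i))^`()) (fun i => (geg (cls i))^`())).
by apply: eq_bigr => i _; apply: eq_bigr => j _; rewrite cls_gram.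
Qed.

Hypothesis I_ge0 : forall p, 0 <= I (p * p).

(* For a positive semidefinite matrix, tr(M^2) <= C tr(M) whenever the
   quadratic form of M is bounded by C: test each column of M. *)
Lemma frob_le_trace m C : 0 <= C ->
  (forall x : nat -> R, let p := \sum_(i < m) x i *: geg (cls i) in
    0 < I (p * p) -> I (p^`() * p^`()) <= C * I (p * p)) ->
  frob cls_dnrm cls_nrm m <= C * \sum_(i < m) cls_dnrm i / cls_nrm i.
Proof.
move=> C0 hC; rewrite /frob exchange_big /= mulr_sumr; apply: ler_sum => j _.
pose r := \sum_(i < m) cls_dnrm (minn i j) ^+ 2 / cls_nrm i.
have -> : \sum_(i < m) cls_dnrm (minn i j) ^+ 2 / (cls_nrm i * cls_nrm j) = r / cls_nrm j.
  by rewrite mulr_suml; apply: eq_bigr => i _; rewrite invfM mulrA.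
rewrite mulrA ler_pM2r ?invr_gt0 ?cls_nrm_gt0 //.
have [r0|r0] := leP r 0.
  by apply: (le_trans r0); rewrite mulr_ge0 // ltW // cls_dnrm_gt0.
(* Column [j] in Gegenbauer coordinates: [p] represents the functional q -> I (q' * D) on the class,
   so I (p * p) and I (p' * D) are both [r]. *)
pose x i := cls_dnrm (minn i j) / cls_nrm i.
pose p := \sum_(i < m) x i *: geg (cls i).
have [pp _] := cls_quad m x.
have pr : I (p * p) = r.
  rewrite /p pp; apply: eq_bigr => i _; rewrite /x.
  by have h := lt0r_neq0 (cls_nrm_gt0 i); field.
have := hC x; rewrite /= -/p pr => /(_ r0) hp.
pose D := (geg (cls j))^`().
have pD : I (p^`() * D) = r.
  have -> : p^`() * D = (\sum_(i < m) x i *: (geg (cls i))^`()) * (\sum_(i < 1) 1 *: D).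
    rewrite big_ord1 scale1r /p raddf_sum; congr (_ * _).
    by apply: eq_bigr => i _; rewrite /= derivZ.
  rewrite (I_sum_bilin m 1 x (fun=> 1) (fun i => (geg (cls i))^`()) (fun=> D)).
  apply: eq_bigr => i _; rewrite big_ord1 cls_gram /x.
  by rewrite mulr1 mulrAC -expr2.
have S0 := cls_dnrm_gt0 j.
have DD : I (D * D) = cls_dnrm j by rewrite cls_gram minnn.
(* Cauchy-Schwarz for p' and [D]: removing the projection on [D] leaves r^2 / cls_dnrm j <= I (p' *
   p') <= C * r, and [r] is positive. *)
have := I_ge0 (p^`() - (r / cls_dnrm j) *: D).
have sqrE (c : R) (u v : {poly R}) : (u - c *: v) * (u - c *: v) =
    u * u - (2 * c) *: (u * v) + c ^+ 2 *: (v * v).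
  by rewrite -!mul_polyC polyCM polyC_exp polyC_natr; ring.
rewrite sqrE ID IB !IZ pD DD.
have -> : I (p^`() * p^`()) - 2 * (r / cls_dnrm j) * r + (r / cls_dnrm j) ^+ 2 * cls_dnrm j =
  I (p^`() * p^`()) - r / cls_dnrm j * r.
  by have h := lt0r_neq0 S0; field.
rewrite subr_ge0 => /le_trans /(_ hp); rewrite ler_pM2r //.
by rewrite ler_pdivrMr.
Qed.

End gegenbauer_poly.

(** * Combining the two parity classes *)

Lemma sum_parity (V : zmodType) n (F : nat -> V) : \sum_(k < n) F k =
  \sum_(i < uphalf n) F i.*2 + \sum_(i < n./2) F i.*2.+1.
Proof.
elim: n F => [|n IH] F; first by rewrite !big_ord0 addr0.
rewrite big_ord_recl /= (IH (fun k => F k.+1)) /= big_ord_recl /= -addrA; congr (_ + _).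
by rewrite addrC.
Qed.

Section upper_form.
Variables (R : realFieldType) (lam : R) (I : {poly R} -> R).
Hypothesis hlam : - 2^-1 < lam.
Hypothesis ID : forall p q, I (p + q) = I p + I q.
Hypothesis IZ : forall c p, I (c *: p) = c * I p.
Hypothesis I_by_parts : forall q,
  I ((1 - 'X^2) * q^`() - (2 * lam + 1) *: ('X * q)) = 0.
Hypothesis I1_gt0 : 0 < I 1.

(** The constant, odd and even parts of [p] are mutually orthogonal and so are the derivatives of
    the last two. The class bounds therefore add up, and the constant part only enlarges the
    right-hand side. *)
Lemma deriv_form_le n (p : {poly R}) (B : R) : (size p <= n.+1)%N -> 0 < B ->
  frob (cls_dnrm lam I false) (cls_nrm lam I false) (uphalf n) <= B ^+ 2 ->
  frob (cls_dnrm lam I true) (cls_nrm lam I true) n./2 <= B ^+ 2 ->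
  I (p^`() * p^`()) <= B * I (p * p).
Proof.
move=> sp B0 F0 F1; have [c pE] := geg_span hlam sp.
pose x b i := c (cls b i); pose P b m := \sum_(i < m) x b i *: geg lam (cls b i).
pose p0 := P false (uphalf n); pose p1 := P true n./2.
have pE' : p = c 0 *: 1 + (p0 + p1).
  rewrite pE big_ord_recl /= geg0; congr (_ + _).
  (* After the shift past degree 0, even indices are odd degrees, that is, the class [false]. *)
  exact: (sum_parity n (fun k => c k.+1 *: geg lam k.+1)).
have oddc b i : odd (cls b i) = ~~ b by rewrite /cls /= oddD odd_double addbF oddb.
have o01 : I (p0 * p1) = 0.
  rewrite /p0 /p1 /P (I_sum_bilin ID IZ _ _ (x false) (x true)
    (fun i => geg lam (cls false i)) (fun i => geg lam (cls true i))).
  rewrite big1 // => i _; rewrite big1 // => j _; rewrite (geg_orth hlam ID IZ) ?mulr0 //.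
  by apply/eqP => /(congr1 odd); rewrite !oddc.
have o0 b m : I (1 * P b m) = 0.
  have -> : 1 * P b m = (\sum_(i < 1) 1 *: geg lam 0) * P b m.
    by rewrite big_ord1 scale1r.
  rewrite /P (I_sum_bilin ID IZ 1 m (fun=> 1) (x b) (fun=> geg lam 0) (fun i => geg lam (cls b i))).
  by rewrite big_ord1 big1 // => i _; rewrite (geg_orth hlam ID IZ) ?mulr0.
have d01 : I (p0^`() * p1^`()) = 0.
  have dE b m : (P b m)^`() = \sum_(i < m) x b i *: (geg lam (cls b i))^`().
    by rewrite /P raddf_sum; apply: eq_bigr => i _; rewrite /= derivZ.
  rewrite /p0 /p1 !dE (I_sum_bilin ID IZ _ _ (x false) (x true)
    (fun i => (geg lam (cls false i))^`()) (fun i => (geg lam (cls true i))^`())).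
  rewrite big1 // => i _; rewrite big1 // => j _.
  by rewrite (dgeg_orth hlam ID IZ) ?mulr0 // !oddc.
have [q0 d0] := cls_quad hlam ID IZ I_by_parts false (uphalf n) (x false).
have [q1 d1] := cls_quad hlam ID IZ I_by_parts true n./2 (x true).
have dpE : p^`() = p0^`() + p1^`() by rewrite pE' !derivD derivZ derivC scaler0 add0r.
have -> : I (p^`() * p^`()) = I (p0^`() * p0^`()) + I (p1^`() * p1^`()).
  rewrite dpE; have -> : (p0^`() + p1^`()) * (p0^`() + p1^`()) =
    p0^`() * p0^`() + p1^`() * p1^`() + 2 *: (p0^`() * p1^`()).
    by rewrite -mul_polyC polyC_natr; ring.
  by rewrite !ID IZ d01 mulr0 addr0.
have -> : I (p * p) = c 0 ^+ 2 * I 1 + (I (p0 * p0) + I (p1 * p1)).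
  rewrite pE'; have -> : (c 0 *: 1 + (p0 + p1)) * (c 0 *: 1 + (p0 + p1)) =
    c 0 ^+ 2 *: 1 + (p0 * p0 + p1 * p1) + (2 * c 0) *: (1 * p0) + (2 * c 0) *: (1 * p1)
    + 2 *: (p0 * p1).
    by rewrite -!mul_polyC polyC_exp polyCM !polyC_natr; ring.
  by rewrite !ID !IZ o01 !o0 !mulr0 !addr0.
have g b := cls_nrm_gt0 hlam ID IZ I_by_parts I1_gt0 b.
have h0 := quad_form_le_frob (g false) (x false) B0 F0.
have h1 := quad_form_le_frob (g true) (x true) B0 F1.
rewrite -d0 -q0 in h0; rewrite -d1 -q1 in h1.
have h2 : 0 <= B * (c 0 ^+ 2 * I 1).
  by apply: mulr_ge0; [exact: ltW | apply: mulr_ge0; [exact: sqr_ge0 | exact: ltW]].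
rewrite !mulrDr; apply: (le_trans (lerD h0 h1)).
by rewrite -[X in X <= _]add0r lerD.
Qed.

End upper_form.

(** * The Markov constant *)

Section markov.
Variables (R : realType) (n : nat) (lam : R).
Hypotheses (hn : (0 < n)%N) (hlam : - 2^-1 < lam).

Let ID := fun p q => @gintD R lam p q hlam.
Let IZ := fun c p => @gintZ R lam c p hlam.
Let IP := fun q => @gint_by_parts R lam q hlam.
Let I1 := gint1_gt0 hlam.
Let I_ge0 p : 0 <= gint lam (p * p).
Proof. by rewrite -expr2 gint_sqr_ge0. Qed.

Definition markov_upper : R :=
  (n%:R + 5 / 4 * lam + 9 / 8) ^+ 4 / (2 * (2 * lam + 1) * Num.sqrt (2 * lam + 5)).

Lemma markov_upper_gt0 : 0 < markov_upper.
Proof.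
have hl := hlam; have n1 : 1 <= n%:R :> R by rewrite ler1n.
apply: divr_gt0; first by rewrite exprn_gt0 //; lra.
by rewrite mulr_gt0 ?sqrtr_gt0 //; lra.
Qed.

Lemma markov_upper_sqr : markov_upper ^+ 2 = upper_sq lam n%:R.
Proof.
have hl := hlam; have l1 : 2 * lam + 1 != 0 by apply: lt0r_neq0; lra.
have l5 : 0 <= 2 * lam + 5 by lra.
rewrite /markov_upper /upper_sq expr_div_n -exprM; congr (_ / _).
by rewrite exprMn sqr_sqrtr //; ring.
Qed.

Lemma upper_sq_le k : 0 <= k <= n%:R -> upper_sq lam k <= markov_upper ^+ 2.
Proof.
have hl := hlam; move=> /andP[k0 kn]; rewrite markov_upper_sqr /upper_sq ler_pM2r.
  by rewrite lerXn2r ?nnegrE; lra.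
by rewrite invr_gt0 !mulr_gt0 // ?exprn_gt0; lra.
Qed.

(** The two classes end at degrees n and n - 1, in the order given by the parity of n; monotonicity
    of [upper_sq] brings both under its value at n. *)
Lemma deriv_gint_le (p : {poly R}) : (size p <= n.+1)%N ->
  gint lam (p^`() ^+ 2) <= markov_upper * gint lam (p ^+ 2).
Proof.
move=> sp; rewrite !expr2.
have n2 := odd_double_half n.
apply: (deriv_form_le hlam ID IZ IP I1 sp markov_upper_gt0).
- apply: (le_trans (frob_le_upper_sq hlam ID IZ IP I1 false _)); apply: upper_sq_le.
  have -> : false%:R + 2 * (uphalf n)%:R - 1 = (uphalf n).*2%:R - 1 :> R.
    by rewrite -mul2n natrM add0r.
  rewrite subr_ge0 lerBlDr natr1 ler1n ler_nat; apply/andP; split.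
    by rewrite double_gt0 uphalf_gt0.
  by rewrite -[X in (_ <= X.+1)%N]n2 uphalf_half doubleD; case: (odd n).
- apply: (le_trans (frob_le_upper_sq hlam ID IZ IP I1 true _)); apply: upper_sq_le.
  have -> : true%:R + 2 * (n./2)%:R - 1 = (n./2).*2%:R :> R.
    by rewrite -mul2n natrM (_ : true%:R = 1) //; ring.
  by rewrite ler0n ler_nat -[X in (_ <= X)%N]n2 leq_addl.
Qed.

Lemma markov_lower C : 0 <= C ->
  (forall p : {poly R}, (size p <= n.+1)%N -> 0 < gint lam (p ^+ 2) ->
     gint lam (p^`() ^+ 2) <= C * gint lam (p ^+ 2)) ->
  lower lam n%:R <= C.
Proof.
(* The class that contains the degree n itself, with exactly its members up to n. *)
move=> C0 hC; pose b := ~~ odd n; pose m := uphalf n.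
have bm : (b + m.*2 = n.+1)%N.
  rewrite /b /m uphalf_half doubleD -[in RHS](odd_double_half n).
  by case: (odd n); rewrite //= !addnA.
have kE : b%:R + 2 * m%:R - 1 = n%:R :> R.
  by rewrite -natrM mul2n -natrD bm -natr1; ring.
have h1 := frob_ge_lower hlam ID IZ IP I1 b m; rewrite kE in h1.
have h2 : frob (cls_dnrm lam (gint lam) b) (cls_nrm lam (gint lam) b) m <=
    C * \sum_(i < m) cls_dnrm lam (gint lam) b i / cls_nrm lam (gint lam) b i.
  apply: (frob_le_trace hlam ID IZ IP I1 I_ge0 C0) => x p; rewrite -!expr2.
  apply: hC; rewrite (leq_trans (size_sum _ _ _)) //; apply/bigmax_leqP => i _.
  rewrite (leq_trans (size_scale_leq _ _)) // (size_geg hlam) /cls -bm -!addnS.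
  by rewrite leq_add2l -doubleS leq_double.
have := le_trans h1 h2; rewrite ler_pM2r //.
have m0 : (0 < m)%N by rewrite uphalf_gt0.
rewrite (bigD1 (Ordinal m0)) //=; apply: ltr_pwDl.
  by rewrite divr_gt0 ?(cls_dnrm_gt0 hlam ID IZ IP I1) ?(cls_nrm_gt0 hlam ID IZ IP I1).
apply: sumr_ge0 => i _; apply: ltW.
by rewrite divr_gt0 ?(cls_dnrm_gt0 hlam ID IZ IP I1) ?(cls_nrm_gt0 hlam ID IZ IP I1).
Qed.

Lemma markov_ratioE p :
  Defs.gnorm lam (fun t => (p^`()).[t]) / Defs.gnorm lam (fun t => p.[t]) =
  Num.sqrt (gint lam (p^`() ^+ 2)) / Num.sqrt (gint lam (p ^+ 2)).
Proof. by rewrite !gnormE. Qed.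

(** Excludes the value -oo of the supremum and allows inequalities to be squared. *)
Lemma markov_const_ge0 : (0 <= markov_const n lam)%E.
Proof.
apply: (@le_trans _ _ (Defs.gnorm lam (fun t => (1^`()).[t]) /
    Defs.gnorm lam (fun t => 1.[t]))%:E).
  by rewrite lee_fin divr_ge0 // sqrtr_ge0.
apply: ereal_sup_ubound; exists 1 => //.
by split; [rewrite /polys_le /= size_poly1 | exact: oner_neq0].
Qed.

End markov.

Theorem theorem1p1 (R : realType) (n : nat) (lam : R)
  (hn : (3 <= n)%N) (hlam : - 2^-1 < lam) :
  ((((n.+1)%:R * (n%:R + lam + 2^-1) ^+ 2 * (n%:R + 2 * lam))
      / ((2 * lam + 1) * (2 * lam + 5)))%:E
     <= markov_const n lam * markov_const n lam)%E /\
  (markov_const n lam * markov_const n lam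
     <= ((n%:R + 5 / 4 * lam + 9 / 8) ^+ 4
          / (2 * (2 * lam + 1) * Num.sqrt (2 * lam + 5)))%:E)%E.
Proof.
have n0 : (0 < n)%N by exact: leq_trans hn.
have M0 := markov_const_ge0 n lam.
split.
  rewrite -natr1 -/(lower lam n%:R).
  have ub (p : {poly R}) : (size p <= n.+1)%N -> p != 0 ->
      ((Num.sqrt (gint lam (p^`() ^+ 2)) / Num.sqrt (gint lam (p ^+ 2)))%:E
       <= markov_const n lam)%E.
    by move=> sp p0; rewrite -markov_ratioE; apply: ereal_sup_ubound; exists p.
  move: M0 ub; case: (markov_const n lam) => [r||] //; last first.
    by move=> _ _; rewrite mulyy leey.
  rewrite lee_fin => r0 ub; rewrite -EFinM lee_fin -expr2.
  apply: (markov_lower n0 hlam (sqr_ge0 r)) => p sp p0.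
  have pn0 : p != 0.
    apply: contraTneq p0 => ->.
    by rewrite expr2 mulr0 -(scale0r (0 : {poly R})) gintZ // mul0r ltxx.
  have := ub p sp pn0; rewrite lee_fin ler_pdivrMr ?sqrtr_gt0 // => h.
  rewrite -[X in X <= _]sqr_sqrtr ?gint_sqr_ge0 // -[X in _ * X]sqr_sqrtr ?gint_sqr_ge0 //.
  by rewrite -exprMn lerXn2r ?nnegrE ?mulr_ge0 ?sqrtr_ge0.
rewrite -/(markov_upper n lam).
have B0 := ltW (markov_upper_gt0 n0 hlam).
suff h : (markov_const n lam <= (Num.sqrt (markov_upper n lam))%:E)%E.
  rewrite -[X in (_ <= X%:E)%E](sqr_sqrtr B0) expr2 EFinM.
  exact: lee_pmul.
apply: ge_ereal_sup => _ [p [sp p0] <-]; rewrite markov_ratioE lee_fin.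
(* A zero denominator makes the quotient 0, as the inverse of 0 is 0; this case replaces a proof
   that the norm is definite. *)
have [q0|q0] := leP (gint lam (p ^+ 2)) 0.
  by rewrite (ler0_sqrtr q0) invr0 mulr0 sqrtr_ge0.
rewrite ler_pdivrMr ?sqrtr_gt0 // -sqrtrM // ler_sqrt ?(mulr_ge0 B0 (gint_sqr_ge0 _ _)) //.
exact: deriv_gint_le.
Qed.
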